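(* Let $Q$ be an admissible orientation of $\tilde A_n$ and $I,J$ indecomposable linearized semigroup ideals of $\Bbbk Q$ of type II such that $\Gamma_I\cup\Gamma_J=\Gamma$. Then $IJ$ decomposes into a direct sum of two non-zero ideals if and only if, for every maximal path $\omega$ which is an isolated vertex of $\Gamma_I\cap\Gamma_J$ and such that the edge of $\Gamma_J$ incident to $\omega$ is a sink of $Q$, one has $\mathbf{ts}_\omega(J)\ge\mathbf{is}_\omega(I)$.
   Context: $\Bbbk$ is an algebraically closed field. An admissible orientation of $\tilde A_n$ is a finite quiver $Q$ with $n$ vertices whose underlying undirected graph is a cycle, having no oriented cycle and at least one source. Paths include trivial paths $\varepsilon_x$; products are concatenations when defined, $0$ otherwise. Maximal paths are paths not properly contained as subpaths of other paths; each goes from a source to an adjacent sink. A linearized semigroup ideal is an ideal spanned by a set $X$ of paths with $\alpha\omega\beta\in X$ whenever $\omega\in X$ and $\alpha\omega\beta$ is defined. $\Gamma$: vertices the maximal paths, edges the sources and sinks of $Q$, edge $x$ joining the two maximal paths having $x$ as an endpoint. $\Gamma_I$: vertices the maximal paths in $I$, edges the sources/sinks $x$ with $\varepsilon_x\in I$. An indecomposable (non-zero, not a direct sum of two non-zero ideals) linearized semigroup ideal $I$ is of type II if $\Gamma_I$ is a chain with at least two vertices which is not all of $\Gamma$. For a maximal path $\omega$ passing through vertices $u_1\to u_2\to\dots\to u_m$ ($u_1$ a source, $u_m$ a sink, $m$ = length of $\omega$ plus one), let $\omega[c,d]$ ($1\le c\le d\le m$) denote its subpath from $u_c$ to $u_d$.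 For $\omega$ as in the claim ($\omega\in I$, $\varepsilon_{u_m}\in J$) set $\mathbf{is}_\omega(I):=m+1-\max\{c:\omega[c,m]\in I\}$ and $\mathbf{ts}_\omega(J):=m+1-\min\{c:\omega[1,c]\in J\}$ (these are the initial slope of the boundary of $I$ and the terminal slope of the boundary of $J$ in the upper-triangular $m\times m$ matrix block corresponding to $\omega$, where the subpath $\omega[c,d]$ corresponds to the matrix unit $e_{m+1-d,\,m+1-c}$). *)

(* Defs.v *)
From HB Require Import structures.
From mathcomp Require Import all_boot all_order all_algebra.
Set Implicit Arguments. Unset Strict Implicit. Unset Printing Implicit Defensive.
Import GRing.Theory.
Local Open Scope ring_scope.

(* The quiver Q.  Its underlying graph is the cycle on the vertex set 'I_n, *)
(* with one edge i for every i : 'I_n, joining i and i+1 (mod n).           *)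
(* The orientation o : 'I_n -> bool says how edge i is oriented:            *)
(*   o i = true  : arrow  i -> i+1 (mod n)                                  *)
(*   o i = false : arrow  i+1 (mod n) -> i                                  *)
(* (For n = 2 this gives the two parallel edges of the Kronecker graph.)    *)

Section Quiver.
Variable n : nat.
Variable o : 'I_n -> bool.

(* the element  j mod n  of 'I_n  (w only witnesses 0 < n) *)
Definition modI (w : 'I_n) (j : nat) : 'I_n :=
  Ordinal (ltn_pmod j (leq_ltn_trans (leq0n w) (ltn_ord w))).

Definition is_source (x : 'I_n) : bool := o x && ~~ o (modI x (x + n - 1)%N).
Definition is_sink (x : 'I_n) : bool := ~~ o x && o (modI x (x + n - 1)%N).
Definition is_srcsink (x : 'I_n) : bool := is_source x || is_sink x.

(* Q has no oriented cycle (not all arrows go the same way round the cycle) *)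
(* and has at least one source.                                             *)
Definition admissible : Prop :=
  (exists i, o i) /\ (exists i, ~~ o i) /\ (exists x, is_source x).

(* Paths: (start vertex, clockwise direction?, length).  A trivial path      *)
(* eps_x is (x, false, 0); a path of length l > 0 with direction true       *)
(* (resp. false) goes x -> x+1 -> ... -> x+l (resp. x -> x-1 -> ... -> x-l). *)
(* In an acyclic orientation every path has length < n.                      *)
Definition pth : finType := ('I_n * bool * 'I_n)%type.

Definition ps (p : pth) : 'I_n := p.1.1.
Definition pd (p : pth) : bool := p.1.2.
Definition pl (p : pth) : nat := p.2.

Definition vtx (p : pth) (k : nat) : 'I_n :=
  if pd p then modI (ps p) (ps p + k)%N else modI (ps p) (ps p + n - k)%N.

Definition psrc (p : pth) : 'I_n := ps p.
Definition ptgt (p : pth) : 'I_n := vtx p (pl p).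

Definition arrow_ok (p : pth) (k : nat) : bool :=
  if pd p then o (modI (ps p) (ps p + k)%N)
  else ~~ o (modI (ps p) (ps p + n - k.+1)%N).

Definition valid (p : pth) : bool :=
  ((pl p != 0%N) || ~~ pd p) && [forall k : 'I_n, (k < pl p)%N ==> arrow_ok p k].

Definition eps (x : 'I_n) : pth := (x, false, modI x 0).

(* concat p q r  <->  r = p q, the product in kQ, i.e. the path that first   *)
(* follows q and then p (defined when the target of q is the source of p).   *)
Definition concat (p q r : pth) : bool :=
  [&& valid p, valid q, valid r, ptgt q == psrc p, ps r == ps q,
      pl r == (pl q + pl p)%N, (pl q == 0%N) || (pd r == pd q)
    & (pl p == 0%N) || (pd r == pd p)].

Definition is_max (w : pth) : bool :=
  [&& valid w, [forall a, forall r, concat a w r ==> (r == w)]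
    & [forall b, forall r, concat w b r ==> (r == w)]].

(* X is the (path) basis of a linearized semigroup ideal *)
Definition lsg_ideal (X : {set pth}) : Prop :=
  (forall p, p \in X -> valid p) /\
  (forall p q r, concat p q r -> (p \in X) || (q \in X) -> r \in X).

(* The path algebra kQ: functions pth -> K supported on valid paths,        *)
(* the value at p being the coefficient of the path p.                      *)
Section Algebra.
Variable K : fieldType.

Definition elt := {ffun pth -> K}.

Definition in_kQ (f : elt) : Prop := forall p, f p != 0 -> valid p.

Definition mulQ (f g : elt) : elt :=
  [ffun r => \sum_(p : pth) \sum_(q : pth | concat p q r) f p * g q].

Definition scaleQ (c : K) (f : elt) : elt := [ffun p => c * f p].

Definition is_ideal (A : elt -> Prop) : Prop :=
  [/\ forall f, A f -> in_kQ f,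
      A 0,
      forall f g, A f -> A g -> A (f + g),
      forall c f, A f -> A (scaleQ c f)
    & forall f a, in_kQ f -> A a -> A (mulQ f a) /\ A (mulQ a f)].

Definition lin (X : {set pth}) (f : elt) : Prop := forall p, f p != 0 -> p \in X.

Definition prodI (A B : elt -> Prop) (s : elt) : Prop :=
  exists l : seq (elt * elt),
    (forall x, x \in l -> A x.1 /\ B x.2) /\ s = \sum_(x <- l) mulQ x.1 x.2.

Definition decomposes (S : elt -> Prop) : Prop :=
  exists A B : elt -> Prop,
    [/\ is_ideal A /\ is_ideal B,
        (exists a, A a /\ a != 0), (exists b, B b /\ b != 0),
        (forall x, A x -> B x -> x = 0)
      & forall s, S s <-> exists a b, [/\ A a, B b & s = a + b]].

Definition indecomposable (S : elt -> Prop) : Prop :=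
  (exists s, S s /\ s != 0) /\ ~ decomposes S.

End Algebra.

(* The graphs Gamma and Gamma_I.  Vertices: maximal paths; edges: sources   *)
(* and sinks x of Q, edge x joining the two maximal paths with endpoint x.  *)
Definition incident (x : 'I_n) (w : pth) : bool := (psrc w == x) || (ptgt w == x).

Definition joins (x : 'I_n) (v w : pth) : bool :=
  [&& v != w, incident x v & incident x w].

Definition GV (X : {set pth}) : pred pth := [pred w | is_max w && (w \in X)].
Definition GE (X : {set pth}) : pred 'I_n := [pred x | is_srcsink x && (eps x \in X)].

Definition chain2 (V : pred pth) (E : pred 'I_n) : Prop :=
  exists (vs : seq pth) (es : seq 'I_n),
    [/\ uniq vs /\ uniq es, vs =i V /\ es =i E, (2 <= size vs)%N,
        size es = (size vs).-1
      & all (fun t => joins t.1 t.2.1 t.2.2) (zip es (zip vs (behead vs)))].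

Definition full_graph (X : {set pth}) : Prop :=
  (forall w, is_max w -> w \in X) /\ (forall x, is_srcsink x -> eps x \in X).

Definition typeII (K : fieldType) (X : {set pth}) : Prop :=
  [/\ lsg_ideal X, indecomposable (lin (K:=K) X), chain2 (GV X) (GE X)
    & ~ full_graph X].

Definition union_full (X Y : {set pth}) : Prop :=
  (forall w, is_max w -> (w \in X) || (w \in Y)) /\
  (forall x, is_srcsink x -> (eps x \in X) || (eps x \in Y)).

Definition isolated_cap (X Y : {set pth}) (w : pth) : Prop :=
  [/\ is_max w, w \in X, w \in Y &
      forall x, is_srcsink x -> incident x w ->
        ~~ ((eps x \in X) && (eps x \in Y))].

(* the subpath w[c,d] (1 <= c <= d <= m = length w + 1) from u_c to u_d *)
Definition subp (w : pth) (c d : nat) : pth :=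
  (vtx w c.-1, (c < d)%N && pd w, modI (ps w) (d - c)%N).

Definition is_slope (X : {set pth}) (w : pth) : nat :=
  let m := (pl w).+1 in
  (m.+1 - \max_(c < m.+1 | (1 <= c)%N && (subp w c m \in X)) c)%N.

Definition ts_slope (Y : {set pth}) (w : pth) : nat :=
  let m := (pl w).+1 in
  (m.+1 - \big[minn/m]_(c < m.+1 | (1 <= c)%N && (subp w 1 c \in Y)) c)%N.

End Quiver.

(* Main.v *)
(* The product IJ is spanned by the set Z of the products of paths of X and Y.  Cutting
   the cycle at a source or sink x missing from X and at one, y, missing from Y gives two
   arcs, and Z splits accordingly into two parts, each spanning an ideal because no path
   has a source or sink in its interior.  Walking along an arc from the first cut, the
   last source or sink missing from X is followed by one lying in X: either that one is in
   Y too, and its trivial path is in Z, or the maximal path between them is isolated in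
   the intersection graph.  Such a path lies in Z automatically, unless its sink is in Y,
   in which case it does so iff the slope inequality holds.  So the inequalities make both
   parts non-zero.  If one of them fails, the isolated path w is not in Z.  Then Z has at
   most one path between any two vertices, so every path of Z is in one of the two
   summands of a decomposition of IJ; and since the graphs of X and Y are chains, the
   sources and sinks between two maximal paths of Z on the arc complementary to w are all
   in Z, so that all of these maximal paths lie in the same summand. *)
Require Import Defs.
From mathcomp Require Import all_boot all_order all_algebra.
From mathcomp Require Import zify.

Set Implicit Arguments. Unset Strict Implicit. Unset Printing Implicit Defensive.
Import GRing.Theory.

(** * Ideals spanned by paths *)

Section Ideals.
Variables (n : nat) (o : 'I_n -> bool).
Implicit Types (p q r z : pth n) (X Y Z : {set pth n}).

Lemma pl_eps (x : 'I_n) : pl (eps x) = 0.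
Proof. by rewrite /pl /= mod0n. Qed.

Lemma ptgt_eps (x : 'I_n) : ptgt (eps x) = x.
Proof.
by apply: val_inj; rewrite /ptgt pl_eps /vtx /= subn0 modnDr modn_small.
Qed.

Lemma valid_eps (x : 'I_n) : valid o (eps x).
Proof.
by rewrite /valid pl_eps; apply/forallP => k; rewrite ltn0.
Qed.

(** Start and length of the product are forced, and a factor of positive length forces its
    direction. If both factors are trivial, validity fixes the direction to [false]. *)
Lemma concat_funr p q r r' : concat o p q r -> concat o p q r' -> r = r'.
Proof.
case/and5P=> _ _ /andP[vr _] _ /and4P[/eqP s1 /eqP l1 d1 e1].
case/and5P=> _ _ /andP[vr' _] _ /and4P[/eqP s2 /eqP l2 d2 e2].
case: r r' vr vr' s1 l1 d1 e1 s2 l2 d2 e2 => [[s d] l] [[s' d'] l'].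
rewrite /ps /pd /pl /= => vr vr' -> l1 d1 e1 -> l2 d2 e2.
have el : l = l' by apply: val_inj; rewrite /= l1.
rewrite -{}el l1 in vr vr' *; congr (_, _, _).
case: (posnP q.2) d1 d2 => [q0 _ _|_ /eqP-> /eqP-> //].
case: (posnP p.2) e1 e2 => [p0 _ _|_ /eqP-> /eqP-> //].
by move: vr vr'; rewrite q0 p0 /= => /negbTE-> /negbTE->.
Qed.

Lemma concat_eps_r p : valid o p -> concat o p (eps (psrc p)) p.
Proof.
by move=> vp; rewrite /concat vp valid_eps ptgt_eps pl_eps !eqxx !orbT.
Qed.

Lemma concat_eps_l p : valid o p -> concat o (eps (ptgt p)) p p.
Proof.
by move=> vp; rewrite /concat vp valid_eps pl_eps addn0 !eqxx !orbT.
Qed.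

Lemma concat_valid p q r : concat o p q r -> [/\ valid o p, valid o q & valid o r].
Proof. by case/and5P. Qed.

Lemma concat_epsE_r p r x : concat o p (eps x) r -> p = r /\ psrc r = x.
Proof.
move=> h; have [vp _ _] := concat_valid h.
case/and5P: (h) => _ _ _; rewrite ptgt_eps => /eqP sx /and4P[/eqP sr _ _ _].
by split=> //; apply: concat_funr h; rewrite sx; apply: concat_eps_r.
Qed.

Lemma concat_epsE_l q r x : concat o (eps x) q r -> q = r /\ ptgt r = x.
Proof.
move=> h; have [_ vq _] := concat_valid h.
case/and5P: (h) => _ _ _ /eqP sx _.
have e : q = r by apply: concat_funr h; rewrite -[x]sx; apply: concat_eps_l.
by rewrite -e.
Qed.

Definition prodset X Y : {set pth n} :=
  [set r | [exists p, exists q, [&& p \in X, q \in Y & concat o p q r]]].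

Lemma prodsetP X Y r :
  reflect (exists p q, [/\ p \in X, q \in Y & concat o p q r]) (r \in prodset X Y).
Proof.
rewrite inE; apply: (iffP existsP) => [[p /existsP[q /and3P[]]] | [p [q []]]].
  by exists p, q.
by move=> *; exists p; apply/existsP; exists q; apply/and3P.
Qed.

Lemma prodset_subl X Y : lsg_ideal o X -> prodset X Y \subset X.
Proof.
move=> [_ hX]; apply/subsetP => z /prodsetP[p [q [hp _ h]]].
by apply: (hX _ _ _ h); rewrite hp.
Qed.

Lemma prodset_subr X Y : lsg_ideal o Y -> prodset X Y \subset Y.
Proof.
move=> [_ hY]; apply/subsetP => z /prodsetP[p [q [_ hq h]]].
by apply: (hY _ _ _ h); rewrite hq orbT.
Qed.

Lemma eps_prodset X Y x : eps x \in X -> eps x \in Y -> eps x \in prodset X Y.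
Proof.
move=> hx hy; apply/prodsetP; exists (eps x), (eps x); split=> //.
by have := concat_eps_l (valid_eps x); rewrite ptgt_eps.
Qed.

(** * Spans of paths in the path algebra *)

Section Linear.
Variable K : fieldType.
Local Open Scope ring_scope.

Definition delta p : elt n K := [ffun q => (q == p)%:R].

Lemma mulQE (f g : elt n K) r :
  mulQ o f g r = \sum_(x : pth n * pth n | concat o x.1 x.2 r) f x.1 * g x.2.
Proof. by rewrite ffunE pair_big_dep. Qed.

Lemma mulQ1 (f g : elt n K) p q r : concat o p q r ->
  (forall p' q', concat o p' q' r -> f p' * g q' != 0 -> p' = p /\ q' = q) ->
  mulQ o f g r = f p * g q.
Proof.
move=> h u; rewrite mulQE (bigD1 (p, q)) //= big1 ?addr0 // => -[p' q'] /= /andP[h'].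
by apply: contraNeq => /(u _ _ h')[-> ->].
Qed.

Lemma mulQ0 (f g : elt n K) r :
  (forall p q, concat o p q r -> f p * g q = 0) -> mulQ o f g r = 0.
Proof. by move=> h; rewrite mulQE big1 // => x /h. Qed.

Lemma delta_neq0 p : delta p != 0.
Proof.
apply/eqP=> /(congr1 (fun f : elt n K => f p)); rewrite !ffunE eqxx => /eqP.
by rewrite oner_eq0.
Qed.

Lemma delta_supp p q : delta p q != 0 -> q = p.
Proof. by rewrite ffunE; case: (eqVneq q p) => // _; rewrite eqxx. Qed.

Lemma delta_in_kQ p : valid o p -> in_kQ o (delta p).
Proof. by move=> vp q /delta_supp ->. Qed.

Lemma mul_delta p q r : concat o p q r -> mulQ o (delta p) (delta q) = delta r.
Proof.
move=> h; apply/ffunP => r'; rewrite [RHS]ffunE.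
have u p' q' : delta p p' * delta q q' != 0 -> p' = p /\ q' = q.
  by rewrite mulf_eq0 negb_or => /andP[/delta_supp -> /delta_supp ->].
case: eqP => [-> | ne].
  by rewrite (mulQ1 h) ?ffunE ?eqxx ?mulr1 // => p' q' _; apply: u.
apply: mulQ0 => p' q' h'; apply/eqP/negPn/negP => /u[ep eq]; apply: ne.
by apply: concat_funr h; rewrite -ep -eq.
Qed.

Lemma mul_eps_r (f : elt n K) x :
  mulQ o f (delta (eps x)) = [ffun r => if valid o r && (psrc r == x) then f r else 0].
Proof.
apply/ffunP => r; rewrite [RHS]ffunE; case: ifP => [/andP[vr /eqP sx] | hn].
  rewrite (@mulQ1 _ _ r (eps x)) ?ffunE ?eqxx ?mulr1 //.
    by rewrite -sx; apply: concat_eps_r.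
  move=> p q h; rewrite mulf_eq0 negb_or => /andP[_ /delta_supp e].
  by rewrite e in h *; have [-> _] := concat_epsE_r h.
apply: mulQ0 => p q h; apply/eqP/negPn/negP; rewrite mulf_eq0 negb_or.
case/andP=> _ /delta_supp e; rewrite e in h; have [_ _ vr] := concat_valid h.
by have [_ sx] := concat_epsE_r h; rewrite vr sx eqxx in hn.
Qed.

Lemma mul_eps_l (f : elt n K) x :
  mulQ o (delta (eps x)) f = [ffun r => if valid o r && (ptgt r == x) then f r else 0].
Proof.
apply/ffunP => r; rewrite [RHS]ffunE; case: ifP => [/andP[vr /eqP sx] | hn].
  rewrite (@mulQ1 _ _ (eps x) r) ?ffunE ?eqxx ?mul1r //.
    by rewrite -sx; apply: concat_eps_l.
  move=> p q h; rewrite mulf_eq0 negb_or => /andP[/delta_supp e _].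
  by rewrite e in h *; have [-> _] := concat_epsE_l h.
apply: mulQ0 => p q h; apply/eqP/negPn/negP; rewrite mulf_eq0 negb_or.
case/andP=> /delta_supp e _; rewrite e in h; have [_ _ vr] := concat_valid h.
by have [_ sx] := concat_epsE_l h; rewrite vr sx eqxx in hn.
Qed.

Lemma lin_prodset X Y s :
  prodI o (lin (K := K) X) (lin (K := K) Y) s <-> lin (K := K) (prodset X Y) s.
Proof.
split=> [[l [hl ->]] r | hs].
  apply: contraNT => hr; rewrite sum_ffunE big_seq big1 // => x /hl[hx hy].
  apply: mulQ0 => p q h; apply/eqP/negPn/negP; rewrite mulf_eq0 negb_or.
  by case/andP=> /hx px /hy qy; case/prodsetP: hr; exists p, q.
(* One factorisation is chosen for each path of the product set. The default [(r, r)] never enters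
   the sum, which runs over that set only. *)
pose pr r := if [pick x : pth n * pth n | [&& x.1 \in X, x.2 \in Y & concat o x.1 x.2 r]]
  is Some x then x else (r, r).
have prP r : r \in prodset X Y ->
    [/\ (pr r).1 \in X, (pr r).2 \in Y & concat o (pr r).1 (pr r).2 r].
  case/prodsetP=> p [q [px qy h]]; rewrite /pr; case: pickP => [x /and3P[] // | /(_ (p, q))].
  by rewrite /= px qy h.
exists [seq (scaleQ (s r) (delta (pr r).1), delta (pr r).2) | r <- enum (prodset X Y)].
split=> [x /mapP[r] | ].
  rewrite mem_enum => /prP[px qy h] -> /=; split=> q; last by move/delta_supp ->.
  by rewrite ffunE mulf_eq0 negb_or => /andP[_ /delta_supp ->].
rewrite big_map big_enum /=; apply/ffunP => r; rewrite sum_ffunE.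
have mulZ (f g : elt n K) c z : mulQ o (scaleQ c f) g z = c * mulQ o f g z.
  by rewrite !mulQE mulr_sumr; apply: eq_bigr => x _; rewrite ffunE mulrA.
rewrite (eq_bigr (fun z => s z * (r == z)%:R)); last first.
  by move=> z /prP[_ _ h]; rewrite mulZ (mul_delta h) ffunE.
case: (boolP (r \in prodset X Y)) => hr.
  rewrite (bigD1 r) //= eqxx mulr1 big1 ?addr0 // => z /andP[_ /negbTE].
  by rewrite eq_sym => ->; rewrite mulr0.
rewrite big1 => [|z hz]; first by apply/eqP; apply: contraNT hr; apply: hs.
by case: eqP => [e|_]; [rewrite e hz in hr | rewrite mulr0].
Qed.

Lemma lin_ideal Z : lsg_ideal o Z -> is_ideal o (lin (K := K) Z).
Proof.
case=> hv hc; split.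
- by move=> f hf p /hf /hv.
- by move=> p; rewrite ffunE eqxx.
- move=> f g hf hg p; rewrite ffunE; apply: contraNT => hp.
  have /eqP-> : f p == 0 by apply: contraNT hp; apply: hf.
  by rewrite add0r; apply: contraNT hp; apply: hg.
- by move=> c f hf p; rewrite ffunE mulf_eq0 negb_or => /andP[_ /hf].
move=> f a _ ha; split=> r; apply: contraNT => hr; apply/eqP/mulQ0 => p q h;
    apply/eqP/negPn/negP; rewrite mulf_eq0 negb_or => /andP[h1 h2]; case/negP: hr.
  by apply: hc h _; rewrite (ha _ h2) orbT.
by apply: hc h _; rewrite (ha _ h1).
Qed.

Lemma decomposes_ext (S T : elt n K -> Prop) :
  (forall s, S s <-> T s) -> decomposes o S <-> decomposes o T.
Proof.
move=> h; split=> -[A [B [hi hA hB h0 hs]]]; exists A, B; split=> // s.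
  by rewrite -h hs.
by rewrite h hs.
Qed.

(** Multiplying a path of [Z] by any path preserves its colour, so each colour class of [Z] spans an
    ideal; the two witnesses make both ideals non-zero. *)
Lemma lin_decomposes Z (c : pth n -> bool) : lsg_ideal o Z ->
  (forall p q r, concat o p q r -> p \in Z -> c r = c p) ->
  (forall p q r, concat o p q r -> q \in Z -> c r = c q) ->
  (exists2 z, z \in Z & c z) -> (exists2 z, z \in Z & ~~ c z) ->
  decomposes o (lin (K := K) Z).
Proof.
move=> [hv hc] cl cr [z1 zZ1 c1] [z2 zZ2 c2].
pose Zb b := [set z in Z | c z == b].
have lsgZb b : lsg_ideal o (Zb b).
  split=> [p | p q r h]; first by rewrite inE => /andP[/hv].
  rewrite !inE => /orP[/andP[hp /eqP <-]|/andP[hq /eqP <-]].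
    by rewrite (hc _ _ _ h) ?hp //= (cl _ _ _ h) ?eqxx.
  by rewrite (hc _ _ _ h) ?hq ?orbT //= (cr _ _ _ h) ?eqxx.
have linD z b : z \in Zb b -> lin (K := K) (Zb b) (delta z) by move=> h p /delta_supp ->.
exists (lin (K := K) (Zb true)), (lin (K := K) (Zb false)); split.
- by split; apply: lin_ideal.
- by exists (delta z1); split; [apply: linD; rewrite inE zZ1 c1 | apply: delta_neq0].
- by exists (delta z2); split; [apply: linD; rewrite inE zZ2 (negbTE c2) | apply: delta_neq0].
- move=> f h1 h2; apply/ffunP => p; rewrite ffunE; apply/eqP/negPn/negP => hp.
  by have := h1 p hp; have := h2 p hp; rewrite !inE => /andP[_ /eqP ->] /andP[_].
move=> s; split=> [hs | [a [b [ha hb ->]]] p].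
  exists [ffun p => if c p then s p else 0], [ffun p => if c p then 0 else s p]; split.
  - by move=> p; rewrite ffunE inE; case: ifP => [_ /hs -> | _] //; rewrite eqxx.
  - by move=> p; rewrite ffunE inE; case: ifP => [_ | _ /hs ->] //; rewrite eqxx.
  by apply/ffunP => p; rewrite !ffunE; case: ifP; rewrite ?addr0 ?add0r.
rewrite ffunE; case: (eqVneq (a p) 0) => [-> | /ha]; last by rewrite inE => /andP[].
by rewrite add0r => /hb; rewrite inE => /andP[].
Qed.

Lemma ideal_concat (A : elt n K -> Prop) p q r : is_ideal o A -> concat o p q r ->
  A (delta p) \/ A (delta q) -> A (delta r).
Proof.
move=> [_ _ _ _ hA] h; have [vp vq _] := concat_valid h; rewrite -(mul_delta h).
by case=> /hA ha; apply ha; apply: delta_in_kQ.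
Qed.

(** Multiplying [a] by the idempotents at the two ends of [z] keeps only the terms parallel to [z].
    In [Z] there is just [z] itself, so a non-zero multiple of [delta z] is left. *)
Lemma ideal_delta (A : elt n K -> Prop) Z a z : is_ideal o A ->
  (forall f, A f -> lin (K := K) Z f) ->
  (forall z', z' \in Z -> psrc z' = psrc z -> ptgt z' = ptgt z -> z' = z) ->
  A a -> a z != 0 -> A (delta z).
Proof.
move=> [kA _ _ sA mA] AZ u ha hz; have vz := kA _ ha _ hz.
have kd x : in_kQ o (delta (eps x)) by apply/delta_in_kQ/valid_eps.
have [_ h1] := mA _ _ (kd (psrc z)) ha.
have [h2 _] := mA _ _ (kd (ptgt z)) h1.
suff -> : delta z = scaleQ (a z)^-1
    (mulQ o (delta (eps (ptgt z))) (mulQ o a (delta (eps (psrc z))))) by apply: sA.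
apply/ffunP => p; rewrite mul_eps_l mul_eps_r !ffunE.
case: eqP => [-> | ne]; first by rewrite vz !eqxx /= mulVf.
case: ifP => [/andP[_ /eqP tp] | _]; last by rewrite mulr0.
case: ifP => [/andP[_ /eqP sp] | _]; last by rewrite mulr0.
case: (eqVneq (a p) 0) => [-> | hp]; first by rewrite mulr0.
by case: ne; apply: u => //; apply: AZ hp.
Qed.

(** By [ideal_delta], each summand contains every path in the support of its elements. Writing
    [delta z] as a sum of an element of [A] and one of [B], one of the two has a non-zero
    coefficient at [z], so [z] belongs to that summand. *)
Lemma decomposes_paths Z : lsg_ideal o Z ->
  {in Z &, forall z z', psrc z' = psrc z -> ptgt z' = ptgt z -> z' = z} ->
  decomposes o (lin (K := K) Z) ->
  exists P Q : pth n -> Prop,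
    [/\ (forall z, z \in Z -> P z \/ Q z) /\ (forall z, P z -> Q z -> False),
        forall p q r, concat o p q r -> P p \/ P q -> P r,
        forall p q r, concat o p q r -> Q p \/ Q q -> Q r,
        exists2 z, z \in Z & P z & exists2 z, z \in Z & Q z].
Proof.
move=> hZ u [A [B [[iA iB] [a [ha a0]] [b [hb b0]] AB0 hs]]].
have AZ f : A f -> lin (K := K) Z f.
  by move=> hf; apply/hs; exists f, 0; split; rewrite ?addr0 //; case: iB.
have BZ f : B f -> lin (K := K) Z f.
  by move=> hf; apply/hs; exists 0, f; split; rewrite ?add0r //; case: iA.
have dA f z : A f -> f z != 0 -> A (delta z).
  by move=> hf hz; apply: (ideal_delta iA AZ _ hf hz) => z' hz'; apply: u => //; apply: (AZ f).
have dB f z : B f -> f z != 0 -> B (delta z).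
  by move=> hf hz; apply: (ideal_delta iB BZ _ hf hz) => z' hz'; apply: u => //; apply: (BZ f).
have nz (f : elt n K) : f != 0 -> exists z, f z != 0.
  move=> hf; apply/existsP; apply: contraNT hf; rewrite negb_exists => /forallP h.
  by apply/eqP/ffunP => z; rewrite ffunE; apply/eqP/negPn.
exists (fun z => A (delta z)), (fun z => B (delta z)); split.
- split=> [z hz | z hA hB]; last by move: (AB0 _ hA hB) => /eqP; apply/negP/delta_neq0.
  have /hs[a1 [b1 [ha1 hb1 e]]] : lin (K := K) Z (delta z) by move=> p /delta_supp ->.
  case: (eqVneq (a1 z) 0) => [z0 | /(dA _ _ ha1)]; last by left.
  right; apply: (dB b1) => //; move/(congr1 (fun f : elt n K => f z)): e.
  rewrite !ffunE z0 eqxx add0r => <-.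
  exact: oner_neq0.
- by move=> p q r; apply: ideal_concat.
- by move=> p q r; apply: ideal_concat.
- by have [z hz] := nz _ a0; exists z; [apply: AZ hz | apply: dA hz].
by have [z hz] := nz _ b0; exists z; [apply: BZ hz | apply: dB hz].
Qed.

End Linear.
End Ideals.

(** * Paths as intervals of positions *)

Section Cover.
Variables (n : nat) (o : 'I_n -> bool) (w0 : 'I_n).

(* Computations take place on the universal cover of the cycle: the position [k] lies
   over the vertex [k mod n], and [seg d a l] is the path covering the interval of
   positions [a, a + l], upwards if [d] and downwards otherwise. *)
Definition vert (k : nat) : 'I_n := modI w0 k.
Definition ori (k : nat) : bool := o (vert k).
(** Marks the positions over sources and sinks. The predecessor of [k] is taken as [k + n - 1], over
    the same vertex, to avoid truncated subtraction at [0]. *)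
Definition turn (k : nat) : bool := ori (k + n - 1) != ori k.

Definition seg (d : bool) (a l : nat) : pth n :=
  (vert (if d then a else a + l), d && (0 < l), vert l).

(** The interval between two consecutive sources or sinks. By [arc_max] and [max_arc] below, the
    paths covering such intervals are exactly the maximal paths. *)
Definition block (a l : nat) : Prop :=
  [/\ 0 < l, l < n, turn a, turn (a + l)
    & forall j, a <= j < a + l -> ori j = ori a].

Definition arc (a l : nat) : pth n := seg (ori a) a l.

Lemma n_gt0 : 0 < n. Proof. exact: leq_ltn_trans (leq0n w0) (ltn_ord w0). Qed.

Lemma modI_vert (x : 'I_n) k : modI x k = vert k.
Proof. exact: val_inj. Qed.

Lemma vert_small k : k < n -> vert k = k :> nat.
Proof. by move=> h; rewrite /= modn_small. Qed.

Lemma vert_val (x : 'I_n) : vert x = x.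
Proof. by apply: val_inj; rewrite /= modn_small. Qed.

Lemma vertDn k : vert (k + n) = vert k.
Proof. by apply: val_inj; rewrite /= modnDr. Qed.

Lemma vert_addr a b j : vert a = vert b -> vert (a + j) = vert (b + j).
Proof.
by move/(congr1 val) => /= h; apply: val_inj; rewrite /= -modnDml h modnDml.
Qed.

Lemma vert_addrI a b j : vert (a + j) = vert (b + j) -> vert a = vert b.
Proof.
move/(congr1 val) => /= h; apply: val_inj => /=; apply/eqP.
by rewrite -(eqn_modDr j) h.
Qed.

Lemma vert_inj b j k :
  b <= j < b + n -> b <= k < b + n -> vert j = vert k -> j = k.
Proof.
move=> hj hk; have {1 2}-> : j = (j - b) + b by lia.
have {1 2}-> : k = (k - b) + b by lia.
move/vert_addrI/(congr1 val); rewrite /= !modn_small; lia.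
Qed.

Lemma vert_lift b (x : 'I_n) : exists2 k, b <= k < b + n & x = vert k.
Proof.
(* The residue of [x - b] modulo [n] is added to [b]; the summand [n] keeps the difference
   non-negative. *)
exists (b + (x + n - b %% n) %% n).
  by rewrite leq_addr ltn_add2l ltn_pmod ?n_gt0.
apply: val_inj; rewrite /= modnDmr -modnDml.
have hb := ltn_pmod b n_gt0.
by rewrite subnKC ?modnDr; [rewrite modn_small|lia].
Qed.

Lemma ori_vert a b : vert a = vert b -> ori a = ori b.
Proof. by rewrite /ori => ->. Qed.

Lemma turn_vert a b : vert a = vert b -> turn a = turn b.
Proof.
move=> h; rewrite /turn (ori_vert h) (@ori_vert _ (b + n - 1)) //.
by rewrite -!addnBA ?n_gt0 //; apply: vert_addr.
Qed.

Lemma turnS k : turn k.+1 = (ori k != ori k.+1).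
Proof.
by rewrite /turn (@ori_vert _ k) // (_ : k.+1 + n - 1 = k + n) ?vertDn //; lia.
Qed.

Lemma turnDn k : turn (k + n) = turn k.
Proof. by apply: turn_vert; rewrite vertDn. Qed.

Lemma vtx_true (p : pth n) a k : pd p -> ps p = vert a -> vtx p k = vert (a + k).
Proof.
move=> hd hs; rewrite /vtx hd modI_vert; apply: vert_addr.
by rewrite hs vert_val.
Qed.

Lemma vert_back (x : 'I_n) a k : x = vert (a + k) -> k <= n -> vert (x + n - k) = vert a.
Proof.
move=> hx hk; apply: (@vert_addrI _ _ k).
by rewrite subnK ?vertDn ?vert_val //; lia.
Qed.

Lemma vtx_false (p : pth n) a k :
  ~~ pd p -> ps p = vert (a + k) -> k <= n -> vtx p k = vert a.
Proof.
by move=> /negbTE hd hs hk; rewrite /vtx hd modI_vert; apply: vert_back.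
Qed.

Lemma ps_seg d a l : ps (seg d a l) = vert (if d then a else a + l).
Proof. by []. Qed.
Lemma pd_seg d a l : pd (seg d a l) = d && (0 < l).
Proof. by []. Qed.
Lemma pl_seg d a l : l < n -> pl (seg d a l) = l.
Proof. exact: vert_small. Qed.

Lemma ptgt_seg d a l : l < n -> ptgt (seg d a l) = vert (if d then a + l else a).
Proof.
move=> hl; rewrite /ptgt pl_seg //.
case: (posnP l) => [-> | l0].
  by rewrite addn0 if_same; apply: (@vtx_false _ a 0);
    rewrite ?pd_seg ?ps_seg ?andbF ?addn0 ?if_same.
case: d; first by apply: (@vtx_true _ a); rewrite ?pd_seg ?ps_seg ?l0.
by apply: (@vtx_false _ a l); rewrite ?pd_seg ?ps_seg // ltnW.
Qed.

Lemma seg0 d a : seg d a 0 = eps (vert a).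
Proof. by rewrite /seg /eps addn0 if_same andbF modI_vert. Qed.

Lemma seg_vert d a b l : vert a = vert b -> seg d a l = seg d b l.
Proof. by move=> h; rewrite /seg; case: d; rewrite ?h // (vert_addr _ h). Qed.

Lemma seg_inj d d' a b l l' : l < n -> l' < n -> 0 < l -> seg d a l = seg d' b l' ->
  [/\ d = d', l = l' & vert a = vert b].
Proof.
move=> hl hl' l0 h.
have ll : l = l' by rewrite -(pl_seg d a hl) h pl_seg.
have dd : d = d' by have := congr1 (@pd n) h; rewrite !pd_seg -ll l0 !andbT.
split=> //; move/(congr1 (@ps n)): h; rewrite !ps_seg -ll -dd; case: d {dd} => //.
exact: vert_addrI.
Qed.

Lemma valid_seg d a l : l < n ->
  reflect (forall j, a <= j < a + l -> ori j = d) (valid o (seg d a l)).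
Proof.
move=> hl; rewrite /valid pd_seg pl_seg //.
have -> : (l != 0) || ~~ (d && (0 < l)) by case: (l) => [|l1]; rewrite ?andbF.
(* A downward path starts at [a + l], so its arrow number [j] lies over position [a + l - j.+1]. *)
rewrite /=; have key j : j < l ->
    arrow_ok o (seg d a l) j = (ori (if d then a + j else a + l - j.+1) == d).
  move=> hj; have l0 : 0 < l by lia.
  rewrite /arrow_ok pd_seg l0 andbT ps_seg; case: d.
    by rewrite modI_vert eqb_id; congr o; apply: vert_addr; rewrite vert_val.
  rewrite modI_vert eqbF_neg /ori (@vert_back _ (a + l - j.+1)) //; last lia.
  by congr (vert _); lia.
apply: (iffP forallP) => [h j hj | h k].
  case: d h key => h key.
    have hn : j - a < n by lia.
    have /implyP := h (Ordinal hn); rewrite /= key; last lia.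
    by rewrite subnKC; last lia; move=> /(_ _)/eqP; apply; lia.
  have hn : a + l - j.+1 < n by lia.
  have /implyP := h (Ordinal hn); rewrite /= key; last lia.
  by rewrite (_ : a + l - (a + l - j.+1).+1 = j); last lia; move=> /(_ _)/eqP; apply; lia.
by apply/implyP => hk; rewrite key //; apply/eqP; apply: h; case: d {key}; lia.
Qed.

Lemma seg_lift b (p : pth n) : valid o p ->
  exists d a l, [/\ b <= a < b + n, l < n & p = seg d a l].
Proof.
case/andP => h0 _; case: p h0 => [[s d] l] /= h0.
have [k hk sk] := vert_lift b s.
have e1 : vert l = l by exact: vert_val.
exists d; case: d h0; rewrite /pl /pd /= ?orbF => h0.
  by exists k, l; split; rewrite // /seg lt0n h0 e1 sk.
(* For a downward path it is the end point, not the start, that has to be lifted into the window. *)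
have [a ha hs] := vert_lift b (vert (k + n - l)).
exists a, l; split=> //; rewrite /seg e1 /=; congr (_, _, _); rewrite sk.
rewrite -(vert_addr l hs) subnK ?vertDn //; have := ltn_ord l; lia.
Qed.

(** The right factor is followed first; it is the lower part of an upward path but the upper part of
    a downward one, whence the two orders. *)
Lemma concat_seg d a l1 l2 : l1 + l2 < n -> valid o (seg d a (l1 + l2)) ->
  if d then concat o (seg d (a + l1) l2) (seg d a l1) (seg d a (l1 + l2))
  else concat o (seg d a l1) (seg d (a + l1) l2) (seg d a (l1 + l2)).
Proof.
move=> hl hv; have hv' := valid_seg d a hl.
have v1 : valid o (seg d a l1).
  by apply/valid_seg; [lia | move=> j hj; apply: (hv' hv); lia].
have v2 : valid o (seg d (a + l1) l2).
  by apply/valid_seg; [lia | move=> j hj; apply: (hv' hv); lia].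
case: d {hv'} hv v1 v2 => hv v1 v2;
  rewrite /concat hv v1 v2 ptgt_seg ?pl_seg ?pd_seg /psrc ?ps_seg ?eqxx //= ; try lia.
by rewrite addnA eqxx addnC eqxx !orbT.
Qed.

Lemma concat_segV d a l p q : l < n -> concat o p q (seg d a l) ->
  exists l1 l2, l = l1 + l2 /\
   if d then p = seg d (a + l1) l2 /\ q = seg d a l1
   else p = seg d a l1 /\ q = seg d (a + l1) l2.
Proof.
move=> hl /and5P[/andP[vp _] /andP[vq _] vr /eqP tq /and4P[/eqP sq /eqP lr dq dp]].
rewrite pl_seg // in lr; rewrite pd_seg in dq dp.
have lt2 : pl q < n := ltn_ord _.
have eq2 : q = seg d (if d then a else a + pl p) (pl q).
  case: q lr sq dq vq {tq lt2} => [[s e] k]; rewrite /ps /pd /pl /= => lr sq dq vq.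
  rewrite /seg vert_val; congr (_, _, _).
    by rewrite -sq; case: (d) => //; congr (vert _); lia.
  case: (posnP k) => [k0 | k0]; first by rewrite k0 andbF in vq *; case: e vq {dq}.
  have l0 : 0 < l by lia.
  by move: dq; rewrite l0 andbT eqn0Ngt k0 => /eqP.
have eq1 : p = seg d (if d then a + pl q else a) (pl p).
  move: tq; rewrite {1}eq2 ptgt_seg // /psrc.
  case: p lr dp vp {eq2} => [[s e] k]; rewrite /ps /pd /pl /= => lr dp vp sp.
  rewrite /seg vert_val; congr (_, _, _).
    by rewrite -sp; case: (d).
  case: (posnP k) => [k0 | k0]; first by rewrite k0 andbF in vp *; case: e vp {dp}.
  have l0 : 0 < l by lia.
  by move: dp; rewrite l0 andbT eqn0Ngt k0 => /eqP.
case: d eq1 eq2 {vr sq dq dp} => eq1 eq2.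
  by exists (pl q), (pl p).
by exists (pl p), (pl q); split=> //; rewrite addnC.
Qed.

(** Multiplying by the two missing end pieces recovers the whole path. Closure under products thus
    passes from a subpath to any path containing it. *)
Lemma concat_sub d a l c m : l < n -> valid o (seg d a l) -> a <= c -> c + m <= a + l ->
  exists p q r, concat o p (seg d c m) r /\ concat o r q (seg d a l).
Proof.
move=> hl hv hac hcm; have hv' := valid_seg d a hl.
have [i hi] : exists i, c = a + i by exists (c - a); lia.
have [j hj] : exists j, a + l = c + m + j by exists (a + l - (c + m)); lia.
have el : l = i + (m + j) by lia.
have el' : l = i + m + j by lia.
case: d hv hv' => hv hv'.
  exists (seg true (c + m) j), (seg true a i), (seg true c (m + j)); split.
    apply: (@concat_seg true); first lia.
    by apply/valid_seg; [lia | move=> k hk; apply: hv' => //; lia].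
  rewrite hi {1}el; apply: (@concat_seg true); rewrite -?el //.
exists (seg false a i), (seg false (c + m) j), (seg false a (i + m)); split.
  rewrite hi; apply: (@concat_seg false); first lia.
  by apply/valid_seg; [lia | move=> k hk; apply: hv' => //; lia].
have -> : c + m = a + (i + m) by lia.
by rewrite {1}el'; apply: (@concat_seg false); rewrite -?el'.
Qed.

(** * Blocks and maximal paths *)

Lemma is_srcsink_vert k : is_srcsink o (vert k) = turn k.
Proof.
have -> : turn k = (o (modI (vert k) (vert k + n - 1)) != o (vert k)).
  rewrite modI_vert; congr (_ != _); apply: ori_vert.
  by rewrite -!addnBA ?n_gt0 //; apply: vert_addr; rewrite vert_val.
by rewrite /is_srcsink /is_source /is_sink; do 2!case: (o _).
Qed.

Lemma block_vert a b l : vert a = vert b -> block a l -> block b l.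
Proof.
move=> h [l0 ln ta tl hj]; split=> //.
- by rewrite -(turn_vert h).
- by rewrite -(turn_vert (vert_addr l h)).
move=> j hjj; rewrite -(ori_vert h) -(hj (a + (j - b))); last lia.
by apply: ori_vert; rewrite (vert_addr _ h); congr vert; lia.
Qed.

Lemma block_interior a l k : block a l -> a < k < a + l -> ~~ turn k.
Proof.
case=> _ _ _ _ hj; case: k => // k hk.
by rewrite turnS negbK (hj k) ?(hj k.+1) //; lia.
Qed.

(** The block ends at the first later position where the orientation changes. Such a change occurs
    within [n - 1] steps, because [turn a] says that [a + n - 1] is oriented differently from
    [a]. *)
Lemma block_next a : turn a -> exists l, block a l.
Proof.
move=> ta; have n0 := n_gt0.
pose P l := (0 < l) && (ori (a + l) != ori a).
have Pn : P (n - 1).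
  rewrite /P addnBA // -/(turn a) ta andbT ltnNge; apply: contraL ta => hn.
  by rewrite /turn (_ : a + n - 1 = a) ?eqxx //; lia.
case: (ex_minnP (ex_intro P _ Pn)) => m /andP[m0 hm] mmin; exists m.
have hlt j : j < m -> ori (a + j) = ori a.
  case: (posnP j) => [-> | j0 jm]; first by rewrite addn0.
  apply/eqP/negPn/negP => hj; have := mmin j; rewrite /P j0 hj => /(_ isT); lia.
split=> //.
- by have := mmin _ Pn; lia.
- case: m m0 hm {mmin} hlt => // m _ hm hlt.
  by rewrite addnS turnS (hlt m) // eq_sym -addnS.
move=> j hj; have -> : j = a + (j - a) by lia.
by apply: hlt; lia.
Qed.

(** Descend from [k] to the nearest turn, less than [n] steps away by periodicity; [n <= k] leaves
    room for this. The block starting there must pass beyond [k], as its end is again a turn. *)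
Lemma block_at k : (exists j, turn j) -> n <= k ->
  exists a l, block a l /\ a <= k < a + l.
Proof.
move=> [t ht] nk; have n0 := n_gt0.
have [u hu tu] := vert_lift (k - n + 1) (vert t).
have exP : exists j, (j <= k) && turn (k - j).
  exists (k - u); apply/andP; split; first lia.
  by rewrite (_ : k - (k - u) = u) -?(turn_vert tu) //; lia.
case: (ex_minnP exP) => m /andP[mk hm] mmin.
have [l hl] := block_next hm; exists (k - m), l; split=> //.
have [l0 _ _ tl _] := hl.
case: (ltnP k (k - m + l)) => hk; first lia.
have := mmin (k - (k - m + l)); rewrite leq_subr (_ : k - _ = k - m + l) ?tl; last lia.
by move=> /(_ isT); lia.
Qed.

(** Each end of a block is a turn, so it cannot lie in the interior of the other block. *)
Lemma block_eq a l a' l' k : block a l -> block a' l' ->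
  a <= k < a + l -> a' <= k < a' + l' -> a = a' /\ l = l'.
Proof.
move=> b b' hk hk'; have [l0 _ ta tl _] := b; have [l0' _ ta' tl' _] := b'.
have n1 : ~ (a < a' < a + l) by move/(block_interior b); rewrite ta'.
have n2 : ~ (a' < a < a' + l') by move/(block_interior b'); rewrite ta.
have n3 : ~ (a < a' + l' < a + l) by move/(block_interior b); rewrite tl'.
have n4 : ~ (a' < a + l < a' + l') by move/(block_interior b'); rewrite tl.
lia.
Qed.

Lemma arc_valid a l : block a l -> valid o (arc a l).
Proof. by case=> l0 ln ta tl hj; apply/valid_seg. Qed.

Lemma seg_interior d c m k : m < n -> valid o (seg d c m) -> c < k < c + m -> ~~ turn k.
Proof.
move=> hm /(valid_seg _ _ hm) h; case: k => // k hk.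
by rewrite turnS negbK !h //; lia.
Qed.

(** A path has no turn in its interior, so it cannot run across an end of the block. *)
Lemma block_sub a l d c m k : block a l -> m < n -> valid o (seg d c m) ->
  a <= k < a + l -> c <= k < c + m -> [/\ a <= c, c + m <= a + l & d = ori a].
Proof.
move=> b hm hv hk hk'; have [l0 _ ta tl hj] := b.
have n1 : ~ (c < a < c + m) by move/(seg_interior hm hv); rewrite ta.
have n2 : ~ (c < a + l < c + m) by move/(seg_interior hm hv); rewrite tl.
split; [lia | lia |].
by rewrite -(hj k hk) ((valid_seg _ _ hm) hv k).
Qed.

Lemma block_seg d c m : (exists j, turn j) -> n <= c -> m < n -> valid o (seg d c m) ->
  exists a l, [/\ block a l, a <= c < a + l, c + m <= a + l & seg d c m = seg (ori a) c m].
Proof.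
move=> ht nc mn hv; have [a [l [b hc]]] := block_at ht nc; exists a, l.
(* A trivial path forgets its direction, so it may be given that of the block. *)
case: (posnP m) => [-> | m0]; first by rewrite !seg0; split=> //; lia.
by have [h1 h2 ->] := block_sub b mn hv hc ltac:(lia); split.
Qed.

Lemma concat_arc a l d c m : block a l -> a <= c -> c + m <= a + l ->
  seg d c m = seg (ori a) c m ->
  exists p q r, concat o p (seg d c m) r /\ concat o r q (arc a l).
Proof.
move=> b h1 h2 ->; have [_ ln _ _ _] := b.
exact: concat_sub ln (arc_valid b) h1 h2.
Qed.

(** A path having the arc as a factor covers the whole block, while [block_sub] prevents it from
    leaving the block. *)
Lemma arc_max a l : block a l -> is_max o (arc a l).
Proof.
move=> b; have [l0 ln ta tl hj] := b; have n0 := n_gt0.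
have key d c m e : m < n -> valid o (seg d c m) -> vert e = vert a ->
    c <= e -> e + l <= c + m -> seg d c m = arc a l.
  move=> mn hv he h1 h2; have be := block_vert (esym he) b.
  have [h3 h4 ->] := block_sub be mn hv (k := e) ltac:(lia) ltac:(lia).
  rewrite /arc (ori_vert he); have -> : c = e by lia.
  by have -> : m = l; [lia | apply: seg_vert].
rewrite /is_max arc_valid //=; apply/andP; split; apply/forallP => p; apply/forallP => r;
    apply/implyP => hc; apply/eqP; have [_ _ vr _ _] := and5P hc;
    have [d [c [m [hcn mn er]]]] := seg_lift n vr;
    rewrite er in hc vr *; have [l1 [l2 [em]]] := concat_segV mn hc;
    case: d hc vr {er} => hc vr [e1 e2].
- have [_ ll hv] := seg_inj ln (ltac:(lia) : l1 < n) l0 e2.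
  by apply: (key _ _ _ c) => //; lia.
- have [_ ll hv] := seg_inj ln (ltac:(lia) : l2 < n) l0 e2.
  by apply: (key _ _ _ (c + l1)) => //; lia.
- have [_ ll hv] := seg_inj ln (ltac:(lia) : l2 < n) l0 e1.
  by apply: (key _ _ _ (c + l1)) => //; lia.
- have [_ ll hv] := seg_inj ln (ltac:(lia) : l1 < n) l0 e1.
  by apply: (key _ _ _ c) => //; lia.
Qed.

(** The path lies in some block and extends to its arc by one multiplication on each side;
    maximality makes both multiplications trivial. *)
Lemma max_arc b w : (exists j, turn j) -> is_max o w ->
  exists a l, [/\ b <= a < b + n, block a l & w = arc a l].
Proof.
move=> ht /and3P[vw /forallP h1 /forallP h2].
have [d [c [m [hc mn ew]]]] := seg_lift n vw; rewrite ew in vw h1 h2 *.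
have [a [l [bl ha hm es]]] := block_seg ht (ltac:(lia) : n <= c) mn vw.
have [p [q [r [c1 c2]]]] := concat_arc bl (proj1 (andP ha)) hm es.
have /eqP er := implyP (forallP (h1 p) r) c1; rewrite er in c2.
have /eqP ea := implyP (forallP (h2 q) _) c2.
have [e he ve] := vert_lift b (vert a); exists e, l; split=> //.
  exact: block_vert bl.
by rewrite -ea /arc -(ori_vert ve); apply: seg_vert.
Qed.

Lemma arc_vert a b l : vert a = vert b -> arc a l = arc b l.
Proof. by move=> h; rewrite /arc (ori_vert h); apply: seg_vert. Qed.

Lemma incident_arc a l x : block a l -> incident x (arc a l) ->
  x = vert a \/ x = vert (a + l).
Proof.
move=> [_ ln _ _ _]; rewrite /incident /arc ptgt_seg // /psrc ps_seg.
by case: (ori a) => /orP[] /eqP <-; auto.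
Qed.

Ltac arith :=
  repeat match goal with H : is_true ?P |- _ =>
    lazymatch P with
    | leq _ _ => fail
    | leq _ _ && leq _ _ => fail
    | ~~ (_ == _) => fail
    | _ => clear H
    end end; lia.

Implicit Types (U X Y Z : {set pth n}) (g : 'I_n -> bool) (p q r w : pth n).

(** * Cutting the cycle *)

(** The colour of a path is read at this vertex, that is, on the arrow just above its lowest
    position; this gives trivial paths a colour too. *)
Definition lower (p : pth n) : 'I_n := if pd p then ps p else ptgt p.

Lemma lower_seg d a l : l < n -> lower (seg d a l) = vert a.
Proof.
move=> ln; rewrite /lower pd_seg ptgt_seg //.
by case: d; case: posnP => //= ->; rewrite addn0.
Qed.

(* The colour [g i] is that of the arrow joining the vertices [i] and [i + 1]. *)
Definition colouring (U : {set pth n}) (g : 'I_n -> bool) : Prop :=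
  forall k, g (vert k.+1) != g (vert k) -> turn k.+1 && (eps (vert k.+1) \notin U).

(** The colour can change only at turns, and the longer path has none inside. The remaining case is
    the trivial path at its upper end, where membership in [U] forbids a change. *)
Lemma colouring_sub U g d a l c m : colouring U g -> l < n -> valid o (seg d a l) ->
  a <= c -> c + m <= a + l -> seg d c m \in U -> g (vert c) = g (vert a).
Proof.
move=> hg ln hv h1 h2 hU.
have run k : a <= k -> k < a + l -> g (vert k) = g (vert a).
  elim: k => [|k IHk] ak kl; first by have -> : a = 0 by arith.
  have [ek | hk] := leqP a k; last by have -> : a = k.+1 by arith.
  rewrite -IHk //; last arith.
  apply/eqP/negPn/negP => /hg/andP[].
  by rewrite (negbTE (seg_interior ln hv _)) //; arith.
have [ca | ] := ltnP c (a + l); first exact: run.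
case: c h1 h2 hU => [|c] h1 h2 hU h3; first by have -> : a = 0 by arith.
have [<- // | ne] := eqVneq a c.+1.
rewrite -(run c); [|arith|arith].
apply/eqP/negPn/negP => /hg/andP[_].
by move: hU; have -> : m = 0 by [arith]; rewrite seg0 => ->.
Qed.

Lemma colouring_concat U g p q r : colouring U g -> concat o p q r ->
  (p \in U -> g (lower r) = g (lower p)) /\ (q \in U -> g (lower r) = g (lower q)).
Proof.
move=> hg h; have [_ _ vr] := concat_valid h.
have [d [a [l [_ ln er]]]] := seg_lift 0 vr; rewrite er in h vr *.
have [l1 [l2 [el e]]] := concat_segV ln h.
have l1n : l1 < n by arith.
have l2n : l2 < n by arith.
have key c m : a <= c -> c + m <= a + l -> seg d c m \in U -> m < n ->
  g (lower (seg d a l)) = g (lower (seg d c m)).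
  by move=> h1 h2 h3 hm; rewrite !lower_seg // (colouring_sub hg ln vr h1 h2 h3).
by case: d {er vr h} e key => -[-> ->] key; split=> hU; apply: key => //; arith.
Qed.

Lemma colouring_incident U g p x : colouring U g -> valid o p -> incident x p ->
  eps x \in U -> g (lower p) = g x.
Proof.
move=> hg vp hi hx; have [d [a [l [_ ln ep]]]] := seg_lift 0 vp.
rewrite ep lower_seg //; rewrite ep in vp hi.
have : x = vert a \/ x = vert (a + l).
  move: hi; rewrite /incident ptgt_seg // /psrc ps_seg.
  by case: (d) => /orP[] /eqP <-; auto.
case=> ex; rewrite ex in hx *; first by [].
rewrite -(seg0 d) in hx.
by rewrite -(colouring_sub hg ln vp _ _ hx) //; arith.
Qed.

(** The arrows from [e] up to [f] get one colour and the rest of the cycle the other, so the colour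
    changes at the two cuts only. *)
Lemma cut_colouring U e f : e < f -> f < e + n -> turn e -> turn f ->
  eps (vert e) \notin U -> eps (vert f) \notin U ->
  exists g, [/\ colouring U g, forall k, e <= k < f -> g (vert k)
              & forall k, f <= k < e + n -> ~~ g (vert k)].
Proof.
move=> ef fn te tf eU fU; pose g x := x \in [seq vert i | i <- iota e (f - e)].
have gE k : e <= k < e + n -> g (vert k) = (k < f).
  move=> hk; apply/mapP/idP => [[i] | kf]; last first.
    by exists k => //; rewrite mem_iota; arith.
  rewrite mem_iota => hi /(vert_inj (b := e)) ->; arith.
exists g; split=> [k | k hk | k hk]; try by rewrite gE; arith.
have [j hj ekj] := vert_lift e (vert k).
have ekj1 : vert k.+1 = vert j.+1 by rewrite -(addn1 k) -(addn1 j); apply: vert_addr.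
rewrite ekj1 ekj (turn_vert ekj1) (gE j) //.
have [jn | jn] := ltnP j.+1 (e + n).
  rewrite gE; last arith.
  by case: (ltngtP j.+1 f) => [h1 | h1 | -> _]; [arith | arith | rewrite tf].
(* The wrap-around: the position after the last of the window lies over the cut [e]. *)
have -> : j.+1 = e + n by arith.
by rewrite turnDn vertDn te.
Qed.

(** Neighbours in the chain share an end whose trivial path is in [U], so by [colouring_incident]
    they have the same colour. Hence cuts outside [U] cannot separate vertices of the chain. *)
Lemma chain_lower U g v w : lsg_ideal o U -> chain2 (GV o U) (GE o U) ->
  colouring U g -> is_max o v -> is_max o w -> v \in U -> w \in U ->
  g (lower v) = g (lower w).
Proof.
move=> [hU _] [vs [es [_ [hvs hes] _ sz hall]]] hg mv mw vU wU.
have iv : v \in vs by rewrite hvs inE mv.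
have iw : w \in vs by rewrite hvs inE mw.
have vvs z : z \in vs -> valid o z by rewrite hvs inE => /andP[_ /hU].
have ves x : x \in es -> eps x \in U by rewrite hes inE => /andP[].
case: vs iv iw vvs sz hall {hvs} => // v0 vs iv iw vvs sz hall.
suff H u : u \in v0 :: vs -> g (lower u) = g (lower v0) by rewrite (H v) // (H w).
elim: vs v0 es u sz hall vvs ves {iv iw hes} => [|v1 vs IH] v0 [|x es] u //= sz.
  by move=> _ _ _; rewrite inE => /eqP->.
case/andP=> /and3P[_ i0 i1] hall vvs ves.
have ex : eps x \in U by apply: ves; rewrite mem_head.
have v0v : valid o v0 by apply: vvs; rewrite mem_head.
have v1v : valid o v1 by apply: vvs; rewrite !inE eqxx orbT.
rewrite (colouring_incident hg v0v i0 ex) inE => /predU1P[-> | hu].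
  exact: colouring_incident ex.
rewrite -(colouring_incident hg v1v i1 ex); apply: (IH v1 es) => //.
- by case: sz.
- by move=> z hz; apply: vvs; rewrite inE hz orbT.
by move=> z hz; apply: ves; rewrite inE hz orbT.
Qed.

(** With at least two vertices in the chain, each has a neighbour and hence an edge. *)
Lemma chain_incident U v : chain2 (GV o U) (GE o U) -> is_max o v -> v \in U ->
  exists x, [/\ is_srcsink o x, eps x \in U & incident x v].
Proof.
move=> [vs [es [_ [hvs hes] sz2 sz hall]]] mv vU.
have iv : v \in vs by rewrite hvs inE mv.
suff [x] : exists2 x, x \in es & incident x v.
  by rewrite hes inE => /andP[h1 h2] h3; exists x.
elim: vs es sz2 sz hall iv {hvs hes} => [|v0 [|v1 vs] IH] [|x es] //= _ [sz].
case/andP=> /and3P[_ i0 i1] hall; rewrite inE => /predU1P[-> | hv].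
  by exists x; rewrite ?mem_head.
case: vs es sz IH hall hv => [|v2 vs] es sz IH hall hv.
  by exists x; rewrite ?mem_head //; move: hv; rewrite inE => /eqP->.
by have [||||y hy ?] := IH es => //; exists y; rewrite // inE hy orbT.
Qed.

Lemma lsg_sub U d a l c m : lsg_ideal o U -> l < n -> valid o (seg d a l) ->
  a <= c -> c + m <= a + l -> seg d c m \in U -> seg d a l \in U.
Proof.
move=> [_ hc] ln hv h1 h2 hU; have [p [q [r [c1 c2]]]] := concat_sub ln hv h1 h2.
have rU : r \in U by apply: (hc _ _ _ c1); rewrite hU orbT.
by apply: (hc _ _ _ c2); rewrite rU.
Qed.

Lemma lsg_eps U a l k : lsg_ideal o U -> block a l -> a <= k <= a + l ->
  eps (vert k) \in U -> arc a l \in U.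
Proof.
move=> hU b hk; rewrite -(seg0 (ori a)); have [_ ln _ _ _] := b.
apply: (lsg_sub hU ln (arc_valid b)); arith.
Qed.

(** * Slopes *)

(** Vertices of a path are numbered from [1] along its direction: number [c] is at position
    [a + c.-1] going up and [a + (l.+1 - c)] going down. *)
Lemma subp_hi a l c : block a l -> 0 < c <= l.+1 ->
  subp (arc a l) c l.+1 = seg (ori a) (if ori a then a + c.-1 else a) (l.+1 - c).
Proof.
move=> [l0 ln _ _ _] hc; rewrite /subp /arc pd_seg modI_vert l0 andbT /seg.
have -> : (c < l.+1) = (0 < l.+1 - c) by arith.
congr (_, _, _); last exact: andbC.
case E: (ori a); first by apply: vtx_true; rewrite // /pd /= l0.
apply: vtx_false; [by [] | | arith].
by rewrite /ps /=; congr (vert _); arith.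
Qed.

Lemma subp_lo a l c : block a l -> 0 < c <= l.+1 ->
  subp (arc a l) 1 c = seg (ori a) (if ori a then a else a + (l.+1 - c)) c.-1.
Proof.
move=> [l0 ln _ _ _] hc; rewrite /subp /arc pd_seg modI_vert l0 andbT /seg subn1.
have -> : (1 < c) = (0 < c.-1) by arith.
congr (_, _, _); last exact: andbC.
case E: (ori a); first by rewrite (@vtx_true _ a) ?addn0 // /pd /= l0.
rewrite (@vtx_false _ (a + l) 0) ?addn0 //.
by congr (vert _); arith.
Qed.

Lemma bigminn_le (s : seq nat) m (P : pred nat) c :
  c \in s -> P c -> \big[minn/m]_(i <- s | P i) i <= c.
Proof.
elim: s => // x s IH; rewrite inE big_cons => /predU1P[<- -> | cs Pc].
  exact: geq_minl.
by case: ifP => _; rewrite ?geq_min IH ?orbT.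
Qed.

Lemma bigminn_attained (s : seq nat) m (P : pred nat) :
  \big[minn/m]_(i <- s | P i) i = m \/ P (\big[minn/m]_(i <- s | P i) i).
Proof.
elim: s => [|x s IH]; rewrite ?big_nil ?big_cons; first by left.
case: ifP => // Px; set b := \big[_/_]_(i <- s | _) _ in IH *.
by case: (leqP x b) => _; [right | exact: IH].
Qed.

(* Both slopes describe the positions [c] at which [w] can be cut: [subp w c m \in X] is
   a downward closed condition on [c] and [subp w 1 c \in Y] an upward closed one, and
   [w] is in the product iff some [c] satisfies both. *)
Lemma slope_le X Y a l : lsg_ideal o X -> lsg_ideal o Y -> block a l ->
  arc a l \in X -> arc a l \in Y ->
  (is_slope X (arc a l) <= ts_slope Y (arc a l)) = (arc a l \in prodset o X Y).
Proof.
move=> hX hY b aX aY; have [l0 ln _ _ _] := b.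
pose PX c := (0 < c) && (subp (arc a l) c l.+1 \in X).
pose PY c := (0 < c) && (subp (arc a l) 1 c \in Y).
(* The extreme cuts give the whole path. So the maximum is attained, and the default value [l.+1] of
   the minimum is itself admissible. *)
have full : PX 1 /\ PY l.+1.
  by rewrite /PX /PY subp_hi // addn0 if_same subn1.
have plE : pl (arc a l) = l by exact: pl_seg.
have iE : is_slope X (arc a l) = l.+2 - \max_(c < l.+2 | PX c) c.
  by rewrite /is_slope plE.
have tE : ts_slope Y (arc a l) = l.+2 - \big[minn/l.+1]_(c <- iota 0 l.+2 | PY c) c.
  rewrite /ts_slope plE; congr (_ - _).
  by rewrite -[iota 0 l.+2]/(index_iota 0 l.+2) big_mkord.
rewrite {}iE {}tE; set mx := \max_(_ < _ | _) _; set mn := \big[_/_]_(_ <- _ | _) _.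
have mxP c : c <= l.+1 -> PX c -> c <= mx.
  by move=> hc hP; apply: (leq_bigmax_cond (Ordinal (hc : c < l.+2))).
have mx_at : PX mx /\ mx <= l.+1.
  have [|c Pc e] := @eq_bigmax_cond _ [pred c : 'I_l.+2 | PX c] (@nat_of_ord l.+2).
    by apply/card_gt0P; exists (Ordinal (isT : 1 < l.+2)); rewrite inE; case: full.
  by rewrite /mx e -ltnS; split; [exact: Pc | exact: ltn_ord].
have mnP c : c <= l.+1 -> PY c -> mn <= c.
  by move=> hc; apply: bigminn_le; rewrite mem_iota.
have mn_at : PY mn.
  by have [e | //] := bigminn_attained (iota 0 l.+2) l.+1 PY; rewrite /mn e; case: full.
have mn_le : mn <= l.+1 by apply: mnP => //; case: full.
have va := arc_valid b.
apply/idP/prodsetP => [h | [p [q [pX qY h]]]].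
  (* Cut at [mx]: the final piece is in [X] by choice, and the initial piece is in [Y] because it
     contains the one ending at [mn]. *)
  have le : mn <= mx by arith.
  case: mx_at => /andP[mx0 hx] mxl; case/andP: mn_at => mn0 hy.
  exists (subp (arc a l) mx l.+1), (subp (arc a l) 1 mx).
  rewrite subp_hi ?mx0 // in hx *; rewrite subp_lo ?mn0 // in hy; rewrite subp_lo ?mx0 //.
  have [i ei] : exists i, mx = i.+1 by exists mx.-1; arith.
  have [j ej] : exists j, mn = j.+1 by exists mn.-1; arith.
  have [k ek] : exists k, l = i + k by exists (l - i); arith.
  rewrite ei ej /= !subSS in hx hy le mxl *.
  have := @concat_seg (ori a) a; rewrite /arc in va *.
  case: (ori a) va hx hy => va hx hy cs; split=> //.
  - apply: (lsg_sub hY _ _ _ _ hy); try arith.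
    by apply/valid_seg => [|t ht]; [arith | apply: ((valid_seg _ _ ln) va); arith].
  - by have := cs i k; rewrite ek addKn; apply; rewrite -?ek.
  - apply: (lsg_sub hY _ _ _ _ hy); try arith.
    by apply/valid_seg => [|t ht]; [arith | apply: ((valid_seg _ _ ln) va); arith].
  by have := cs k i; rewrite ek addKn (addnC i k); apply; rewrite addnC -?ek.
have [l1 [l2 [el e]]] := concat_segV ln h.
(* The cut vertex has number one more than the length of [q], the factor followed first. *)
pose c := (if ori a then l1 else l2).+1.
have cl : 0 < c <= l.+1 by rewrite /c !ltnS el; case: (ori a); rewrite ?leq_addr ?leq_addl.
suff [h1 h2] : PX c /\ PY c.
  have /andP[_ cl1] := cl.
  by apply: leq_sub2l; apply: leq_trans (mnP c cl1 h2) (mxP c cl1 h1).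
rewrite /PX /PY subp_hi // subp_lo // /c !subSS /= el.
case: (ori a) e => -[ep eq]; rewrite ep eq in pX qY; rewrite ?addKn ?addnK //.
Qed.

(** * Decomposing the product *)

Lemma isolated_arc X Y a l : block a l -> arc a l \in X -> arc a l \in Y ->
  ~~ ((eps (vert a) \in X) && (eps (vert a) \in Y)) ->
  ~~ ((eps (vert (a + l)) \in X) && (eps (vert (a + l)) \in Y)) ->
  isolated_cap o X Y (arc a l).
Proof.
move=> b aX aY h1 h2; split=> //; first exact: arc_max.
by move=> x _ hi; have [-> | ->] := incident_arc b hi.
Qed.

Lemma ptgt_arc a l : block a l -> exists2 k, turn k & ptgt (arc a l) = vert k.
Proof.
move=> [_ ln ta tl _]; rewrite /arc ptgt_seg //.
by case: (ori a); [exists (a + l) | exists a].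
Qed.

(** Take the last turn before [f] satisfying [P]; the block starting there ends at a turn where [P]
    fails, possibly [f] itself. *)
Lemma next_failure (P : pred nat) e f : e < f -> turn e -> turn f -> P e -> ~~ P f ->
  exists a l, [/\ block a l, e <= a, a + l <= f, P a & ~~ P (a + l)].
Proof.
move=> ef te tf Pe Pf.
pose Q k := [&& e <= k, k < f, turn k & P k].
have Qe : Q e by rewrite /Q leqnn ef te.
case: (ex_maxnP (ex_intro Q _ Qe) (m := f)) => [k /and4P[_ /ltnW] // |].
move=> a /and4P[ea af ta Pa] amax; have [l b] := block_next ta.
have [l0 _ _ tl _] := b; exists a, l.
have alf : a + l <= f.
  by rewrite leqNgt; apply/negP => h; move: tf; apply/negP/(block_interior b); arith.
split=> //; have [-> // | ne] := eqVneq (a + l) f.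
apply/negP => Pl; have := amax (a + l); rewrite /Q tl Pl; arith.
Qed.

(** Apply [next_failure] to absence from [X]. The start of the block found is then in [Y] and its
    end in [X], so its arc is in both; the two alternatives depend on whether the end is also in
    [Y]. *)
Lemma meet_between X Y e f : lsg_ideal o X -> lsg_ideal o Y ->
  (forall k, turn k -> (eps (vert k) \in X) || (eps (vert k) \in Y)) ->
  e < f -> turn e -> turn f -> eps (vert e) \notin X -> eps (vert f) \notin Y ->
  (exists2 k, e < k < f & (eps (vert k) \in X) && (eps (vert k) \in Y)) \/
  (exists a l, [/\ block a l, e <= a < f, arc a l \in X /\ arc a l \in Y,
     eps (vert a) \notin X & eps (vert (a + l)) \notin Y]).
Proof.
move=> hX hY cov ef te tf eX fY.
have fX : eps (vert f) \in X by have := cov _ tf; rewrite (negbTE fY) orbF.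
have [||a [l [b ea lf aX]]] := @next_failure (fun k => eps (vert k) \notin X) e f ef te tf.
  by [].
  by rewrite fX.
rewrite negbK => lX; have [l0 ln ta tl _] := b.
have aY : eps (vert a) \in Y by have := cov _ ta; rewrite (negbTE aX).
have [lY | lY] := boolP (eps (vert (a + l)) \in Y).
  left; exists (a + l); last by rewrite lX.
  have ne : a + l <> f by move=> e'; rewrite e' (negbTE fY) in lY.
  arith.
right; exists a, l; split=> //; first arith.
by split; [apply: lsg_eps hX b _ lX; arith | apply: lsg_eps hY b _ aY; arith].
Qed.

(** If all edges were present, so would be all vertices, since a maximal path is a multiple of the
    trivial path at its end. *)
Lemma not_full_turn U b : lsg_ideal o U -> (exists k, turn k) -> ~ full_graph o U ->
  exists k, [/\ b <= k < b + n, turn k & eps (vert k) \notin U].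
Proof.
move=> hU ht nf.
have [/existsP[x /andP[hx xU]] | /existsPn h] :=
    boolP [exists x, is_srcsink o x && (eps x \notin U)].
  have [k hk ex] := vert_lift b x; exists k.
  by rewrite -is_srcsink_vert -ex.
have hs x : is_srcsink o x -> eps x \in U.
  by move=> hx; have := h x; rewrite hx negbK.
case: nf; split=> // w /(max_arc 0 ht)[a [l [_ bl ->]]].
apply: (lsg_eps hU bl (k := a)); first arith.
by apply: hs; rewrite is_srcsink_vert; case: bl.
Qed.

(** * Associativity of concatenation and the product ideal *)

Lemma valid_subseg d a l c m : l < n -> valid o (seg d a l) -> a <= c -> c + m <= a + l ->
  valid o (seg d c m).
Proof.
move=> ln hv h1 h2; apply/valid_seg => [|t ht]; first by arith.
by apply: ((valid_seg _ _ ln) hv); arith.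
Qed.

(** Both ways of bracketing cut the same interval at the same two positions. *)
Lemma concat_assoc_l p q r x s : concat o p q r -> concat o x r s ->
  exists2 y, concat o x p y & concat o y q s.
Proof.
move=> h h'; have [_ _ vs] := concat_valid h'.
have [d [a [l [_ ln es]]]] := seg_lift 0 vs; rewrite es in h' vs *.
have [l1 [l2 [el]]] := concat_segV ln h'; case: d {es} vs h' => vs h' [ex er].
  rewrite er in h; have [|k1 [k2 [ek [ep eq]]]] := concat_segV _ h; first by arith.
  exists (seg true (a + k1) (k2 + l2)).
    rewrite ex ep ek addnA; apply: (@concat_seg true); first by arith.
    by apply: valid_subseg vs _ _ => //; arith.
  have -> : l = k1 + (k2 + l2) by arith.
  rewrite eq; apply: (@concat_seg true); first by arith.
  by apply: valid_subseg vs _ _ => //; arith.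
rewrite er in h; have [|k1 [k2 [ek [ep eq]]]] := concat_segV _ h; first by arith.
exists (seg false a (l1 + k1)).
  rewrite ex ep; apply: (@concat_seg false); first by arith.
  by apply: valid_subseg vs _ _ => //; arith.
have -> : l = (l1 + k1) + k2 by arith.
rewrite eq -addnA; apply: (@concat_seg false); first by arith.
by apply: valid_subseg vs _ _ => //; arith.
Qed.

Lemma concat_assoc_r p q r x s : concat o p q r -> concat o r x s ->
  exists2 y, concat o q x y & concat o p y s.
Proof.
move=> h h'; have [_ _ vs] := concat_valid h'.
have [d [a [l [_ ln es]]]] := seg_lift 0 vs; rewrite es in h' vs *.
have [l1 [l2 [el]]] := concat_segV ln h'; case: d {es} vs h' => vs h' [er ex].
  rewrite er in h; have [|k1 [k2 [ek [ep eq]]]] := concat_segV _ h; first by arith.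
  exists (seg true a (l1 + k1)).
    rewrite eq ex; apply: (@concat_seg true); first by arith.
    by apply: valid_subseg vs _ _ => //; arith.
  have -> : l = (l1 + k1) + k2 by arith.
  rewrite ep -addnA; apply: (@concat_seg true); first by arith.
  by apply: valid_subseg vs _ _ => //; arith.
rewrite er in h; have [|k1 [k2 [ek [ep eq]]]] := concat_segV _ h; first by arith.
exists (seg false (a + k1) (k2 + l2)).
  rewrite ex eq ek addnA; apply: (@concat_seg false); first by arith.
  by apply: valid_subseg vs _ _ => //; arith.
have -> : l = k1 + (k2 + l2) by arith.
rewrite ep; apply: (@concat_seg false); first by arith.
by apply: valid_subseg vs _ _ => //; arith.
Qed.

Lemma lsg_prodset X Y : lsg_ideal o X -> lsg_ideal o Y -> lsg_ideal o (prodset o X Y).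
Proof.
move=> [_ hX] [_ hY]; split=> [r /prodsetP[p [q [_ _ /concat_valid[]]]] // | u v s h].
case/orP=> /prodsetP[p [q [pX qY hpq]]]; apply/prodsetP.
  have [y h1 h2] := concat_assoc_r hpq h.
  by exists p, y; split=> //; apply: (hY _ _ _ h1); rewrite qY.
have [y h1 h2] := concat_assoc_l hpq h.
by exists y, q; split=> //; apply: (hX _ _ _ h1); rewrite pX orbT.
Qed.

Lemma slopes_decompose (K : fieldType) X Y : (exists k, turn k) ->
  lsg_ideal o X -> lsg_ideal o Y -> ~ full_graph o X -> ~ full_graph o Y ->
  (forall x, is_srcsink o x -> (eps x \in X) || (eps x \in Y)) ->
  (forall w, isolated_cap o X Y w -> eps (ptgt w) \in Y -> is_slope X w <= ts_slope Y w) ->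
  decomposes o (lin (K := K) (prodset o X Y)).
Proof.
move=> ht hX hY nX nY cov0 hs; set Z := prodset o X Y.
have cov k : turn k -> (eps (vert k) \in X) || (eps (vert k) \in Y).
  by rewrite -is_srcsink_vert => /cov0.
have cov' k : turn k -> (eps (vert k) \in Y) || (eps (vert k) \in X).
  by rewrite orbC => /cov.
have /subsetP subX : Z \subset X by apply: prodset_subl.
have /subsetP subY : Z \subset Y by apply: prodset_subr.
have isoZ a l : block a l -> isolated_cap o X Y (arc a l) -> arc a l \in Z.
  move=> b iso; have [_ aX aY _] := iso.
  have [tY | tY] := boolP (eps (ptgt (arc a l)) \in Y).
    by rewrite -(slope_le hX hY b aX aY); apply: hs.
  (* A sink missing from [Y] is in [X], so the arc is the product of its trivial path in [X] with
     the arc in [Y]. *)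
  apply/prodsetP; exists (eps (ptgt (arc a l))), (arc a l).
  have [k tk ek] := ptgt_arc b.
  split=> //; first by have := cov k tk; rewrite -ek (negbTE tY) orbF.
  by apply: concat_eps_l; apply: arc_valid.
have [e [_ te eX]] := not_full_turn 0 hX ht nX.
have [f [hf tf fY]] := not_full_turn e hY ht nY.
have ne : e <> f.
  by move=> e'; have := cov e te; rewrite (negbTE eX) e' (negbTE fY).
have ef : e < f by arith.
have fn : f < e + n by arith.
have eZ : eps (vert e) \notin Z by apply: contra eX; apply: subX.
have fZ : eps (vert f) \notin Z by apply: contra fY; apply: subY.
(* As [Z] lies in both [X] and [Y], it misses both cuts; each colour must now be shown to occur in
   [Z]. *)
have [g [hg g1 g0]] := cut_colouring ef fn te tf eZ fZ.
have lower_eps k : lower (eps (vert k)) = vert k by rewrite -(seg0 false) lower_seg ?n_gt0.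
apply: (@lin_decomposes _ _ _ _ (fun z => g (lower z))).
- exact: lsg_prodset.
- by move=> p q r h hp; case: (colouring_concat hg h) => /(_ hp).
- by move=> p q r h hp; case: (colouring_concat hg h) => _ /(_ hp).
- have [[k hk /andP[kX kY]] | [a [l [b ha [aX aY] nx ny]]]] :=
    meet_between hX hY cov ef te tf eX fY.
    by exists (eps (vert k)); [apply: eps_prodset | rewrite lower_eps; apply: g1; arith].
  exists (arc a l); last by rewrite lower_seg; [apply: g1; arith | case: b].
  by apply: isoZ => //; apply: isolated_arc; rewrite // negb_and ?nx ?ny ?orbT.
(* On the other arc, from [f] to the next lift of [e], the roles of [X] and [Y] are exchanged. *)
have ten : turn (e + n) by rewrite turnDn.
have enX : eps (vert (e + n)) \notin X by rewrite vertDn.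
have [[k hk /andP[kY kX]] | [a [l [b ha [aY aX] ny nx]]]] :=
  meet_between hY hX cov' fn tf ten fY enX.
  by exists (eps (vert k)); [apply: eps_prodset | rewrite lower_eps; apply: g0; arith].
exists (arc a l); last by rewrite lower_seg; [apply: g0; arith | case: b].
by apply: isoZ => //; apply: isolated_arc; rewrite // negb_and ?nx ?ny ?orbT.
Qed.

(** * From a decomposition to the slope inequalities *)

Definition ext_closed (P : pth n -> Prop) : Prop :=
  forall p q r, concat o p q r -> P p \/ P q -> P r.

Lemma ext_closed_arc P a l d c m : ext_closed P -> block a l -> a <= c -> c + m <= a + l ->
  seg d c m = seg (ori a) c m -> P (seg d c m) -> P (arc a l).
Proof.
move=> hP b h1 h2 e hc; have [p [q [r [c1 c2]]]] := concat_arc b h1 h2 e.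
by apply: (hP _ _ _ c2); left; apply: (hP _ _ _ c1); right.
Qed.

Lemma ext_closed_eps P a l k : ext_closed P -> block a l -> a <= k <= a + l ->
  P (eps (vert k)) -> P (arc a l).
Proof.
move=> hP b hk; rewrite -(seg0 (ori a)).
apply: (ext_closed_arc hP b); [arith | arith | by []].
Qed.

(** Induction on [c' - c]. The turn ending the first block is in [Z] by the hypothesis on
    intermediate turns; it satisfies [P], as otherwise the arc below it would satisfy [Q] too. So
    the next arc is again in [Z] and satisfies [P], up to the arc at [c']. *)
Lemma no_switch P Q Z b e : ext_closed P -> ext_closed Q ->
  (forall z, z \in Z -> P z \/ Q z) -> (forall z, P z -> Q z -> False) ->
  (forall c m c' m' k, block c m -> block c' m' -> arc c m \in Z -> arc c' m' \in Z ->
     b <= c -> c < k -> k <= c' -> c' < e -> turn k -> eps (vert k) \in Z) ->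
  lsg_ideal o Z ->
  forall c m c' m', block c m -> block c' m' -> arc c m \in Z -> arc c' m' \in Z ->
    b <= c -> c < c' -> c' < e -> P (arc c m) -> Q (arc c' m') -> False.
Proof.
move=> hP hQ PQ dPQ mid hZ c m c' m' bc bc' cZ cZ' hbc hcc hce Pc Qc.
have [N hN] := ubnP (c' - c); elim: N c m bc cZ hbc hcc Pc hN => // N IH c m bc cZ hbc hcc Pc hN.
have [m0 mn tc tm _] := bc; have [m0' mn' tc' _ _] := bc'.
have le : c + m <= c'.
  by rewrite leqNgt; apply/negP => h; move: tc'; apply/negP/(block_interior bc); arith.
have eZ : eps (vert (c + m)) \in Z by apply: (mid c m c' m') => //; arith.
have [k bk] := block_next tm.
have kZ : arc (c + m) k \in Z by apply: lsg_eps hZ bk _ eZ; arith.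
have Pk : P (arc (c + m) k).
  have [Pe | Qe] := PQ _ eZ; first by apply: ext_closed_eps hP bk _ Pe; arith.
  by case: (dPQ _ Pc); apply: ext_closed_eps hQ bc _ Qe; arith.
have [e1 | ne] := eqVneq (c + m) c'.
  apply: (dPQ _ Pk); have [k0 _ _ _ _] := bk; rewrite e1 in bk *.
  by have [_ ->] := block_eq bk bc' (k := c') ltac:(arith) ltac:(arith).
by apply: (IH (c + m) k) => //; arith.
Qed.

(** Were [k] missing from [U], cutting there and at the missing end of the block [a], [l] would give
    [c] and [c'] different colours, against [chain_lower]. The end over [a] is used at its lift
    [a + n]. *)
Lemma chain_between U a l c m c' m' k : lsg_ideal o U -> chain2 (GV o U) (GE o U) ->
  block a l -> (eps (vert a) \notin U) || (eps (vert (a + l)) \notin U) ->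
  block c m -> block c' m' -> arc c m \in U -> arc c' m' \in U ->
  a + l <= c -> c < k -> k <= c' -> c' < a + n -> turn k -> eps (vert k) \in U.
Proof.
move=> hU ch b hab bc bc' cU cU' h1 h2 h3 h4 tk; apply/negPn/negP => kU.
have [l0 ln ta tl _] := b; have [m0 mn _ _ _] := bc; have [m0' mn' _ _ _] := bc'.
have same g : colouring U g -> g (vert c) = g (vert c').
  move=> hg; have := chain_lower hU ch hg (arc_max bc) (arc_max bc') cU cU'.
  by rewrite !lower_seg.
case/orP: hab => hU'.
  have kf : k < a + n by arith.
  have fk : a + n < k + n by arith.
  have [||g [/same hg g1 g0]] := cut_colouring kf fk tk _ kU; rewrite ?turnDn ?vertDn //.
  move: hg; rewrite (g1 c'); last arith.
  by rewrite -vertDn; apply/negP; apply: g0; arith.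
have bk : a + l < k by arith.
have kb : k < a + l + n by arith.
have [g [/same hg g1 g0]] := cut_colouring bk kb tl tk hU' kU.
move: hg; rewrite (g1 c); last arith.
by rewrite (negbTE (g0 c' _)) //; arith.
Qed.

(** Distinct parallel paths run in opposite directions and together cover the cycle. One of them
    then lies in the block of the missing arc, which would force that arc into [Z]. *)
Lemma one_dim_homs Z a l : lsg_ideal o Z -> block a l -> arc a l \notin Z ->
  {in Z &, forall z z', psrc z' = psrc z -> ptgt z' = ptgt z -> z' = z}.
Proof.
move=> hZ b aZ; have [l0 ln ta tl _] := b; have n0 := n_gt0.
have avoid d c m k : m < n -> seg d c m \in Z -> c <= k < c + m -> vert k = vert a -> False.
  move=> mn hc hk ek; have bk := block_vert (esym ek) b.
  have [h1 h2 h3] := block_sub bk mn (hZ.1 _ hc) (k := k) ltac:(arith) hk.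
  case/negP: aZ; rewrite -(arc_vert l ek).
  by apply: lsg_sub (arc_valid bk) h1 h2 _; rewrite -?h3.
(* Placed end to end, the two intervals close up, so [m + m'] is a multiple of [n] below [2 * n]:
   either both paths are trivial or every position of the cycle is covered. *)
have opp c m c' m' : m < n -> m' < n -> seg true c m \in Z -> seg false c' m' \in Z ->
    vert c = vert (c' + m') -> vert (c + m) = vert c' -> seg true c m = seg false c' m'.
  move=> mn mn' hc hc' e1 e2.
  rewrite -(seg_vert false m' e2) in hc' *.
  have e3 : vert c = vert (c + m + m') by rewrite (vert_addr m' e2).
  have [k hk ek] := vert_lift c (vert a).
  have [mm | mm] := ltnP (m + m') n.
    have e4 : c = c + m + m' by apply: (vert_inj (b := c)) e3; arith.
    have -> : m = 0 by arith.
    by have -> : m' = 0 by [arith]; rewrite addn0 !seg0.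
  have e4 : c = c + m + m' - n.
    apply: (vert_inj (b := c)); [arith | arith |].
    by rewrite -(vertDn (c + m + m' - n)) subnK //; arith.
  have [kc | kc] := ltnP k (c + m).
    by case: (avoid _ _ _ k mn hc) => //; arith.
  by case: (avoid _ _ _ k mn' hc') => //; arith.
move=> z z' zZ zZ'.
have [d [c [m [_ mn e]]]] := seg_lift 0 (hZ.1 _ zZ).
have [d' [c' [m' [_ mn' e']]]] := seg_lift 0 (hZ.1 _ zZ').
rewrite {z}e in zZ *; rewrite {z'}e' in zZ' *.
rewrite !ptgt_seg // /psrc !ps_seg.
have same x y i j : i < n -> j < n -> vert x = vert y -> vert (x + i) = vert (y + j) -> i = j.
  move=> hi hj e1; rewrite -(vert_addr j e1) => e2.
  have := @vert_inj x (x + i) (x + j) ltac:(arith) ltac:(arith) e2; arith.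
case: d' d zZ zZ' => -[] zZ zZ' e1 e2.
- by rewrite (same _ _ _ _ mn' mn e1 e2); apply: seg_vert.
- by apply: opp.
- by symmetry; apply: opp.
by rewrite (same _ _ _ _ mn' mn e2 e1); apply: seg_vert.
Qed.

Lemma decompose_slopes (K : fieldType) X Y : (exists k, turn k) ->
  lsg_ideal o X -> lsg_ideal o Y ->
  chain2 (GV o X) (GE o X) -> chain2 (GV o Y) (GE o Y) ->
  decomposes o (lin (K := K) (prodset o X Y)) ->
  forall w, isolated_cap o X Y w -> eps (ptgt w) \in Y -> is_slope X w <= ts_slope Y w.
Proof.
move=> ht hX hY cX cY dec w [mw wX wY iso] tY.
have [a [l [ha b ew]]] := max_arc n ht mw; rewrite {w}ew in mw wX wY iso tY *.
have [l0 ln ta tl _] := b.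
rewrite (slope_le hX hY) //; apply/negPn/negP => wZ.
set Z := prodset o X Y in dec wZ.
have hZ : lsg_ideal o Z by apply: lsg_prodset.
have /subsetP subX : Z \subset X by apply: prodset_subl.
have /subsetP subY : Z \subset Y by apply: prodset_subr.
(* The target of the arc is in [Y], hence by isolation not in [X]; an edge of the chain of [X] at
   this arc is likewise not in [Y]. *)
have ends : [/\ (eps (vert a) \notin X) || (eps (vert (a + l)) \notin X)
    & (eps (vert a) \notin Y) || (eps (vert (a + l)) \notin Y)].
  have [x [hx xX xi]] := chain_incident cX mw wX.
  have xY : eps x \notin Y by have := iso x hx xi; rewrite xX.
  have tX : eps (ptgt (arc a l)) \notin X.
    have [k tk ek] := ptgt_arc b.
    have := iso (ptgt (arc a l)); rewrite {1}ek is_srcsink_vert tk /incident eqxx orbT tY andbT.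
    exact.
  have [ex | ex] := incident_arc b xi; rewrite ex in xX xY;
    rewrite (negbTE xY) ?orbT; split=> //; move: tX; rewrite /arc ptgt_seg //;
    by case: (ori a); rewrite ?xX // => ->; rewrite ?orbT.
have [endX endY] := ends.
have [P [Q [[PQ dPQ] hP hQ [z1 zZ1 P1] [z2 zZ2 Q2]]]] :=
  decomposes_paths hZ (one_dim_homs hZ b wZ) dec.
have mid c m c' m' k : block c m -> block c' m' -> arc c m \in Z -> arc c' m' \in Z ->
    a + l <= c -> c < k -> k <= c' -> c' < a + n -> turn k -> eps (vert k) \in Z.
  move=> bc bc' cZ cZ' h1 h2 h3 h4 tk; apply: eps_prodset.
    by apply: (chain_between hX cX b endX bc bc') => //; apply: subX.
  by apply: (chain_between hY cY b endY bc bc') => //; apply: subY.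
(* A path of [Z] is enlarged to a maximal one and lifted to the window starting at [a + l]. It
   cannot be the lift of the missing arc at [a + n], so it starts before that position. *)
have top R z : ext_closed R -> z \in Z -> R z ->
    exists c m, [/\ block c m, a + l <= c < a + n, arc c m \in Z & R (arc c m)].
  move=> hR zZ Rz; have [d [c [m [hc mn ez]]]] := seg_lift n (hZ.1 _ zZ).
  rewrite {z}ez in zZ Rz.
  have [e [k [be he hk es]]] := block_seg ht (ltac:(arith) : n <= c) mn (hZ.1 _ zZ).
  have [h1 _] := andP he.
  have eR := ext_closed_arc hR be h1 hk es Rz.
  have eZ : arc e k \in Z.
    apply: (ext_closed_arc (P := fun p => p \in Z) _ be h1 hk es zZ).
    by move=> p q r h /orP; apply: hZ.2.
  have [f hf ef] := vert_lift (a + l) (vert e).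
  have bf := block_vert ef be; rewrite (arc_vert k ef) in eR eZ.
  exists f, k; split=> //.
  have [k0 _ _ _ _] := bf.
  have fa : ~ (a + n <= f).
    move=> h; have ba : block (a + n) l by apply: block_vert b; rewrite vertDn.
    have [e1 e2] := block_eq ba bf (k := f) ltac:(arith) ltac:(arith).
    by case/negP: wZ; rewrite -(arc_vert l (vertDn a)) e1 e2.
  arith.
have [c [m [bc hc cZ Pc]]] := top _ _ hP zZ1 P1.
have [c' [m' [bc' hc' cZ' Qc]]] := top _ _ hQ zZ2 Q2.
have [m0 _ _ _ _] := bc; have [m0' _ _ _ _] := bc'.
case: (ltngtP c c') => cc.
- by apply: (no_switch hP hQ PQ dPQ mid hZ bc bc') => //; arith.
- have QP z : z \in Z -> Q z \/ P z by move/PQ; case; auto.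
  by apply: (no_switch hQ hP QP (fun z hq hp => dPQ z hp hq) mid hZ bc' bc) => //; arith.
rewrite cc in bc cZ Pc.
have [_ em] := block_eq bc bc' (k := c') ltac:(arith) ltac:(arith).
by apply: (dPQ _ Pc); rewrite em.
Qed.

End Cover.

Theorem theorem27 (K : closedFieldType) (n : nat) (o : 'I_n -> bool)
    (X Y : {set pth n}) :
  admissible o ->
  typeII o K X -> typeII o K Y ->
  union_full o X Y ->
  (decomposes o (prodI o (lin (K:=K) X) (lin (K:=K) Y)) <->
   (forall w : pth n, isolated_cap o X Y w -> eps (ptgt w) \in Y ->
      (is_slope X w <= ts_slope Y w)%N)).
Proof.
move=> [_ [_ [x sx]]] [hX _ cX nX] [hY _ cY nY] [_ cov].
have ht : exists k, turn o x k.
  by exists x; rewrite -is_srcsink_vert vert_val /is_srcsink sx.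
rewrite (decomposes_ext _ (lin_prodset o X Y)); split.
  exact: decompose_slopes ht hX hY cX cY.
exact: slopes_decompose ht hX hY nX nY cov.
Qed.
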